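(* Let $S$ be a finite non-commutative Clifford semigroup, and let $\mathcal{G}(S)$ be its commuting graph. If $\mathcal{G}(S)$ contains at least one cycle, then the girth of $\mathcal{G}(S)$ is equal to $3$.
   Context: A semigroup $S$ is a Clifford semigroup if it is equipped with a unary operation $x\mapsto x^{-1}$ such that for all $x,y\in S$: $(x^{-1})^{-1}=x$, $xx^{-1}x=x$, $x^{-1}x=xx^{-1}$, and $(xx^{-1})(yy^{-1})=(yy^{-1})(xx^{-1})$. Equivalently, $S$ is regular and all its idempotents are central. The center of $S$ is $Z(S)=\{x\in S: xy=yx \text{ for all } y\in S\}$. The commuting graph $\mathcal{G}(S)$ of a finite non-commutative semigroup $S$ is the simple graph with vertex set $S\setminus Z(S)$ in which two distinct vertices $x,y$ are adjacent if and only if $xy=yx$. The girth of a simple graph containing cycles is the length (number of edges) of a shortest cycle. *)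

(* Defs.v *)
From HB Require Import structures.
From mathcomp Require Import all_boot.

Set Implicit Arguments.
Unset Strict Implicit.
Unset Printing Implicit Defensive.

Local Open Scope group_scope.

#[short(type="finSemigroupType")]
HB.structure Definition FinSemigroup := {G of Semigroup G & Finite G}.

Section CliffordSemigroup.
Variable S : semigroupType.

Record clifford_inverse (inv : S -> S) : Prop := CliffordInverse {
  clifford_invK : involutive inv;
  clifford_mulVK : forall x, x * inv x * x = x;
  clifford_invC : forall x, inv x * x = x * inv x;
  clifford_idemC : forall x y,
    (x * inv x) * (y * inv y) = (y * inv y) * (x * inv x)
}.

Definition commutative_semigroup : Prop := forall x y : S, commute x y.

End CliffordSemigroup.

Section CommutingGraph.
Variable S : finSemigroupType.

Definition semigroup_center : {set S} := [set x | [forall y, x * y == y * x]].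

Definition commuting_vertex : finType := {x : S | x \notin semigroup_center}.

Definition commuting_graph : rel commuting_vertex :=
  [rel x y | (x != y) && (val x * val y == val y * val x)].

End CommutingGraph.

Section Girth.
Variables (T : finType) (e : rel T).

(* In a simple graph, the edges of [ucycle e c] form a cycle only when [c] has
   at least three vertices: [ucycle] also accepts [::] and, for symmetric [e],
   both ends of an edge. *)
Definition has_cycle_of_length (n : nat) : bool :=
  (2 < n) && [exists c : n.-tuple T, ucycleb e c].

Definition has_cycle : Prop := exists n, has_cycle_of_length n.

Definition girth (cyc : has_cycle) : nat := ex_minn cyc.

End Girth.

(* Main.v *)
Require Import Defs.
From mathcomp Require Import all_boot.

(** A cycle contains a path [x - y - z] with [x != z]. If [x] and [z] commute,
    this path closes up to a triangle. Otherwise [y], [z], [inv z] form a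
    triangle unless [z] is an involution of its maximal subgroup, and likewise
    for [x]. If both are involutions, then [x * x] and [z * z] are central
    idempotents, so [x * z] and [z * x] commute; they are distinct, non-central
    and commute with [y], which gives a triangle once more. *)

Set Implicit Arguments.
Unset Strict Implicit.
Unset Printing Implicit Defensive.

Section CliffordTheory.

Local Open Scope group_scope.

Variables (S : semigroupType) (inv : S -> S).
Hypothesis invS : clifford_inverse inv.

Let mulVK x : x * inv x * x = x. Proof. exact: clifford_mulVK. Qed.
Let invC x : inv x * x = x * inv x. Proof. exact: clifford_invC. Qed.
Let idemC x y : (x * inv x) * (y * inv y) = (y * inv y) * (x * inv x).
Proof. exact: clifford_idemC. Qed.

(* With [e] the idempotent of [x], the idempotent of [e * y] is absorbed by [e],
   whence [e * y = e * y * e]; dually [y * e = e * y * e]. *)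
Lemma clifford_idem_central x y : commute (x * inv x) y.
Proof.
pose e := x * inv x; rewrite -/e; have ee : e * e = e by rewrite /e mulgA mulVK.
have eC z : e * (z * inv z) = z * inv z * e by rewrite /e idemC.
move: e ee eC => e ee eC {x}.
have eyE : e * y = e * y * e.
  pose g := e * y * inv (e * y).
  have eg : e * g = g by rewrite /g !mulgA ee.
  have ge : g * e = g by rewrite -[RHS]eg /g eC.
  have yg : e * y * g = e * y by rewrite /g -invC mulgA mulVK.
  by rewrite -[LHS]yg -ge mulgA yg.
have yeE : y * e = e * y * e.
  pose h := y * e * inv (y * e).
  have he : h * e = h by rewrite /h -invC -!mulgA ee.
  have eh : e * h = h by rewrite -[RHS]he /h eC.
  have hy : h * (y * e) = y * e by rewrite /h mulVK.
  by rewrite -[LHS]hy -eh -mulgA hy mulgA.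
by rewrite /commute eyE.
Qed.

(** With [e = x * inv x] central, [y * inv x = e * y * inv x = inv x * (x * y) * inv x = inv x * y *
    e], and [inv x] absorbs [e]. *)
Lemma clifford_commuteV x y : commute x y -> commute (inv x) y.
Proof.
move=> xy; have eC := clifford_idem_central x.
have invE z : inv z * z * inv z = inv z.
  by have := mulVK (inv z); rewrite (clifford_invK invS).
have yV : y * inv x = inv x * y * (x * inv x).
  rewrite -{1}(invE x) invC mulgA -(eC y) -invC -(mulgA _ x) xy.
  by rewrite invC -!mulgA.
by rewrite /commute yV -mulgA -(eC y) !mulgA invE.
Qed.

(** Both products equal [x * x * (y * y)], as [x * x] and [y * y] are central. *)
Lemma clifford_commute_mulC x y :
  inv x = x -> inv y = y -> commute (x * y) (y * x).
Proof.
move=> xV yV.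
have xC := clifford_idem_central x; have yC := clifford_idem_central y.
rewrite xV in xC; rewrite yV in yC.
rewrite /commute -!mulgA (mulgA y y) (mulgA x x y) yC xC !mulgA.
by rewrite -[LHS]mulgA xC !mulgA.
Qed.

(** Multiplied by [x] on the left, the hypothesis reads [x * y = x * x * y * x]; here [x * x] is
    central and absorbed by [x]. *)
Lemma commute_involution_mul x y :
  inv x = x -> commute x (x * y) -> commute x y.
Proof.
move=> xV /(congr1 (mul x)).
have := clifford_idem_central x; rewrite xV => xC xy.
have xxx z : x * (x * (x * z)) = x * z by rewrite !mulgA -{2}xV mulVK.
have xxx1 : x * x * x = x by rewrite -{2}xV mulVK.
move: xy; rewrite xxx /commute => ->.
by rewrite -(mulgA x y) [LHS]mulgA xC -[LHS]mulgA (mulgA x x) xxx1.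
Qed.

End CliffordTheory.

Section CommutingGraphTheory.

Local Open Scope group_scope.

Variable S : finSemigroupType.

Lemma notin_center (x y : S) : ~ commute x y -> x \notin semigroup_center S.
Proof. by move=> xy; apply/negP; rewrite inE => /forallP/(_ y)/eqP. Qed.

Lemma commuting_triangle (x y z : S) :
    x \notin semigroup_center S -> y \notin semigroup_center S ->
    z \notin semigroup_center S -> x != y -> y != z -> z != x ->
    commute x y -> commute y z -> commute z x ->
  has_cycle_of_length (@commuting_graph S) 3.
Proof.
move=> xZ yZ zZ nxy nyz nzx xy yz zx; apply/andP; split=> //.
pose c : seq (commuting_vertex S) := [:: Sub x xZ; Sub y yZ; Sub z zZ].
apply/existsP; exists [tuple of c]; rewrite /ucycleb /= !inE -!val_eqE /=.
rewrite /commuting_graph /= -!val_eqE /= negb_or (eq_sym x z).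
by rewrite nxy nyz nzx xy yz zx !eqxx.
Qed.

Variable inv : S -> S.
Hypothesis invS : clifford_inverse inv.

Lemma commuting_path_triangle (x y z : S) :
    x \notin semigroup_center S -> y \notin semigroup_center S ->
    z \notin semigroup_center S -> x != y -> y != z -> z != x ->
    commute x y -> commute y z ->
  has_cycle_of_length (@commuting_graph S) 3.
Proof.
move=> xZ yZ zZ nxy nyz nzx xy yz.
have [/eqP zx | /eqP nC] := boolP (z * x == x * z).
  exact: (commuting_triangle xZ yZ zZ).
(* The ends of the path, in either order, are [u] and [v]. That [inv u] is not central and differs
   from [y] is seen on [v], which commutes with [y] but not with [inv u]. *)
have triV u v : u \notin semigroup_center S -> u != y -> commute u y ->
    commute v y -> ~ commute u v -> inv u != u ->
    has_cycle_of_length (@commuting_graph S) 3.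
  move=> uZ nuy uy vy nuv nVu.
  have VuK w : commute (inv u) w -> commute u w.
    by move/(clifford_commuteV invS); rewrite (clifford_invK invS).
  apply: (@commuting_triangle u y (inv u)) => //.
  - by apply: (@notin_center _ v) => /VuK.
  - by apply/eqP => Vu; apply: nuv; apply: VuK; rewrite -Vu; apply: commute_sym.
  - exact/commute_sym/clifford_commuteV.
  - exact: clifford_commuteV.
have nC' : ~ commute x z by move/commute_sym.
have [xV | nxV] := eqVneq (inv x) x; last exact: (triV x z) nxV.
have [zV | nzV] := eqVneq (inv z) z; last first.
  by apply: (triV z x) nzV => //; rewrite eq_sym.
(* Thus [x] shows that [x * z] is neither central nor equal to [y]; likewise [z] for [z * x]. *)
have nCx : ~ commute x (x * z) by move/(commute_involution_mul invS xV).
have nCz : ~ commute z (z * x) by move/(commute_involution_mul invS zV).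
have yxz : commute y (x * z) by apply: commuteM.
have yzx : commute y (z * x) by apply: commuteM.
apply: (@commuting_triangle y (x * z) (z * x)) => //.
- by apply: (@notin_center _ x) => /commute_sym.
- by apply: (@notin_center _ z) => /commute_sym.
- by apply/eqP => yE; apply: nCx; rewrite -yE.
- by apply/eqP => /esym.
- by apply/eqP => yE; apply: nCz; rewrite yE; apply: commute_sym.
- exact: (clifford_commute_mulC invS).
Qed.

End CommutingGraphTheory.

Theorem theorem3p2 (S : finSemigroupType) (inv : S -> S)
    (S_clifford : clifford_inverse inv)
    (S_noncomm : ~ commutative_semigroup S)
    (G_cyc : has_cycle (@commuting_graph S)) :
  girth G_cyc = 3.
Proof.
have T3 : has_cycle_of_length (@commuting_graph S) 3.
  have [n /andP[n_gt2 /existsP[[c /= /eqP cn]]]] := G_cyc.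
  (* The first three vertices of the cycle give the path; its ends differ by [uniq], as adjacency
     only separates consecutive vertices. *)
  case: c cn => [|x [|y [|z s]]] /= cn; try by rewrite -cn in n_gt2.
  rewrite /ucycleb /= -!andbA => /and5P[nxy /eqP xy nyz /eqP yz].
  case/andP=> _; rewrite !inE !negb_or -!andbA => /and3P[_ nxz _].
  apply: (commuting_path_triangle S_clifford (valP x) (valP y) (valP z)) => //.
  by rewrite eq_sym.
(* The lower bound is the condition [2 < n] in [has_cycle_of_length]. *)
rewrite /girth; case: ex_minnP => m /andP[m_gt2 _] /(_ 3 T3) m_le3.
by apply/eqP; rewrite eqn_leq m_le3.
Qed.
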